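(* Let $G,H$ be locally compact second countable groups and let $(\Omega,\eta)$ be a measure correspondence between $G$ and $H$. Consider the non-singular actions $G\curvearrowright(X,\mu)$ and $H\curvearrowright(Y,\nu)$ associated to $\Omega$, together with the associated cocycles $\omega:G\times X\to H$ and $\beta:H\times Y\to G$. Then both $\omega$ and $\beta$ are proper cocycles.
   Context: **Actions and cocycles.** A non-singular action $G\curvearrowright(X,\mu)$ is a Borel action of a locally compact second countable (l.c.s.c.) group on a standard probability space preserving the class of null sets; here equalities of maps and actions are understood up to null sets. A cocycle is a Borel map $\omega:G\times X\to H$ into an l.c.s.c. group $H$ such that for all $g,h\in G$, $\omega(gh,x)=\omega(g,hx)\omega(h,x)$ for almost every $x\in X$. **Measure correspondence.** Let $G,H$ be l.c.s.c. groups, equipped with Haar measure. A measure correspondence between $G$ and $H$ is a non-singular action $G\times H\curvearrowright(\Omega,\eta)$ for which there exist standard probability spaces $(X,\mu)$, $(Y,\nu)$ and (almost everywhere defined) measure class preserving Borel isomorphisms $\varphi:X\times H\to\Omega$ and $\psi:Y\times G\to\Omega$ such that for all $h\in H$, $\varphi(x,hk)=h\varphi(x,k)$ for almost all $(x,k)\in X\times H$, and for all $g\in G$, $\psi(y,gk)=g\psi(y,k)$ for almost all $(y,k)\in Y\times G$. **Associated actions and cocycles.** Given such $\varphi,\psi$, there are a non-singular action $G\curvearrowright(X,\mu)$ and a cocycle $\omega:G\times X\to H$ such that for every $g\in G$, $g\varphi(x,h)=\varphi(gx,h\,\omega(g,x)^{-1})$ for almost all $(x,h)\in X\times H$; and a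 non-singular action $H\curvearrowright(Y,\nu)$ and a cocycle $\beta:H\times Y\to G$ such that for every $h\in H$, $h\psi(y,g)=\psi(hy,g\,\beta(h,y)^{-1})$ for almost all $(y,g)\in Y\times G$. These are the actions and cocycles associated to $\Omega$ (well defined up to isomorphism of actions and cohomology of cocycles). **Proper cocycle.** A family $\mathcal{A}$ of Borel sets in $X$ is large if it is closed under finite unions and under taking Borel subsets, and for every $\varepsilon>0$ there is $A\in\mathcal{A}$ with $\mu(X\setminus A)<\varepsilon$. A cocycle $\omega:G\times X\to H$ is proper if there is a large family $\mathcal{A}$ such that (1) for every compact $K\subset G$ and all $A,B\in\mathcal{A}$ there is a precompact set $L(K,A,B)\subset H$ such that for every $g\in K$, $\omega(g,x)\in L(K,A,B)$ for almost all $x\in A\cap g^{-1}B$; and (2) for every compact $L\subset H$ and all $A,B\in\mathcal{A}$, the set of all $g\in G$ such that $\mu\{x\in X\mid x\in A,\ gx\in B,\ \omega(g,x)\in L\}>0$ is precompact in $G$. *)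

(* Defs.v *)
From HB Require Import structures.
From mathcomp Require Import all_boot all_order all_algebra.
From mathcomp Require Import all_classical all_reals all_analysis.

Set Implicit Arguments.
Unset Strict Implicit.
Unset Printing Implicit Defensive.

Local Open Scope classical_set_scope.
Local Open Scope ring_scope.
Local Open Scope ereal_scope.

(* The sigma-algebra of a locally compact second countable group is part of the
   structure and is required to be its Borel sigma-algebra. *)
HB.mixin Record isLCSCGroup (d : measure_display) G
    of Group G & PointedTopological G & Measurable d G := {
  mulg_continuous : continuous (fun p : G * G => (p.1 * p.2)%g) ;
  invg_continuous : continuous (fun g : G => g^-1%g) ;
  lcsc_hausdorff : hausdorff_space G ;
  lcsc_locally_compact : locally_compact [set: G] ;
  lcsc_second_countable : @second_countable G ;
  lcsc_borel : @measurable d G = <<s [set A : set G | open A] >>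
}.

#[short(type="lcscGroupType")]
HB.structure Definition LCSCGroup d :=
  {G of Group G & PointedTopological G & Measurable d G & isLCSCGroup d G}.

(* [G * H] carries the product topology and the product sigma-algebra; by
   second countability the latter is the Borel sigma-algebra of the former. *)
Section lcsc_group_prod.
Context d1 d2 (G : lcscGroupType d1) (H : lcscGroupType d2).

Let prod_mulg_continuous :
  continuous (fun p : (G * H) * (G * H) => (p.1 * p.2)%g).
Proof.
move=> [[g h] [g' h']]; apply: cvg_pair => /=.
- apply: (@cvg_comp _ _ _ (fun p : (G * H) * (G * H) => (p.1.1, p.2.1))
    (fun q : G * G => (q.1 * q.2)%g) _ _ _ _ (mulg_continuous (g, g'))).
  by apply: cvg_pair;
    [apply: cvg_comp; [exact: cvg_fst|exact: cvg_fst]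
    |apply: cvg_comp; [exact: cvg_snd|exact: cvg_fst]].
- apply: (@cvg_comp _ _ _ (fun p : (G * H) * (G * H) => (p.1.2, p.2.2))
    (fun q : H * H => (q.1 * q.2)%g) _ _ _ _ (mulg_continuous (h, h'))).
  by apply: cvg_pair;
    [apply: cvg_comp; [exact: cvg_fst|exact: cvg_snd]
    |apply: cvg_comp; [exact: cvg_snd|exact: cvg_snd]].
Qed.

Let prod_invg_continuous : continuous (fun p : G * H => p^-1%g).
Proof.
move=> [g h]; apply: cvg_pair => /=.
- by apply: cvg_comp; [exact: cvg_fst|exact: invg_continuous].
- by apply: cvg_comp; [exact: cvg_snd|exact: invg_continuous].
Qed.

Let prod_hausdorff : hausdorff_space (G * H)%type.
Proof.
move=> [g h] [g' h'] cl; congr pair.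
- apply: lcsc_hausdorff => A B nA nB.
  have [||[x y] [[? _] [? _]]] := cl (A `*` setT) (B `*` setT); last by exists x.
  + by exists (A, setT) => //=; split => //; exact: filterT.
  + by exists (B, setT) => //=; split => //; exact: filterT.
- apply: lcsc_hausdorff => A B nA nB.
  have [||[x y] [[_ ?] [_ ?]]] := cl (setT `*` A) (setT `*` B); last by exists y.
  + by exists (setT, A) => //=; split => //; exact: filterT.
  + by exists (setT, B) => //=; split => //; exact: filterT.
Qed.

Let prod_locally_compact : locally_compact [set: G * H].
Proof.
move=> [g h] _.
have [U nU [cU kU]] := lcsc_locally_compact g Logic.I.
have [V nV [cV kV]] := lcsc_locally_compact h Logic.I.
exists (U `*` V).
  have : nbhs (g, h) (U `*` V).
    exists (U, V) => //=; split.
      by rewrite withinET in nU.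
    by rewrite withinET in nV.
  by rewrite withinET.
split; first exact: compact_setX.
have -> : U `*` V = fst @^-1` U `&` snd @^-1` V by [].
apply: closedI.
- by apply: preimage_closed kU => x _; exact: cvg_fst.
- by apply: preimage_closed kV => x _; exact: cvg_snd.
Qed.

Let open_setX (A : set G) (B : set H) : open A -> open B -> open (A `*` B).
Proof.
have -> : A `*` B = fst @^-1` A `&` snd @^-1` B by [].
move=> oA oB; apply: openI.
- by apply: open_comp oA => x _; exact: cvg_fst.
- by apply: open_comp oB => x _; exact: cvg_snd.
Qed.

Let prod_basis B C : basis B -> basis C ->
  basis ((fun p : set G * set H => p.1 `*` p.2) @` (B `*` C)).
Proof.
move=> [oB bB] [oC bC]; split.
  by move=> _ [[U V] [/= BU CV] <-]; apply: open_setX; [exact: oB|exact: oC].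
move=> [g h] W [[P Q] /= [nP nQ] PQW].
have [U [BU Ug] UP] := bB g P nP.
have [V [CV Vh] VQ] := bC h Q nQ.
exists (U `*` V); first by split => //; exists (U, V).
by move=> [x y] [/= Ux Vy]; apply: PQW; split; [exact: UP|exact: VQ].
Qed.

Let prod_second_countable : @second_countable (G * H)%type.
Proof.
have [B cB bB] := @lcsc_second_countable _ G.
have [C cC bC] := @lcsc_second_countable _ H.
exists ((fun p : set G * set H => p.1 `*` p.2) @` (B `*` C)).
  by apply: card_le_trans (card_image_le _ _) _; exact: countableX.
exact: prod_basis.
Qed.

Let prod_borel : @measurable _ (G * H)%type =
  <<s [set A : set (G * H) | open A] >>.
Proof.
rewrite eqEsubset; split.
  apply: smallest_sub; first exact: smallest_sigma_algebra.
  rewrite subUset; split.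
  - rewrite lcsc_borel -g_sigma_preimageE.
    apply: smallest_sub; first exact: smallest_sigma_algebra.
    move=> _ [A oA <-]; apply: sub_sigma_algebra; rewrite setTI /=.
    by apply: open_comp oA => x _; exact: cvg_fst.
  - rewrite lcsc_borel -g_sigma_preimageE.
    apply: smallest_sub; first exact: smallest_sigma_algebra.
    move=> _ [A oA <-]; apply: sub_sigma_algebra; rewrite setTI /=.
    by apply: open_comp oA => x _; exact: cvg_snd.
apply: smallest_sub; first exact: sigma_algebra_measurable.
move=> W oW.
have [B cB bB] := @lcsc_second_countable _ G.
have [C cC bC] := @lcsc_second_countable _ H.
have -> : W = \bigcup_(p in [set p | (B `*` C) p /\ p.1 `*` p.2 `<=` W])
    (p.1 `*` p.2).
  apply/seteqP; split=> [z Wz|z [p [_ pW] pz]]; last exact: pW.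
  have [|_ [[p BCp <-] pz] pW] := (prod_basis bB bC).2 z W.
    by move: oW; rewrite openE; exact.
  by exists p.
rewrite bigcup_set_type; apply: countable_bigcupT_measurable.
  rewrite (eq_countable (card_setT _)).
  by apply: sub_countable (countableX cB cC); apply: subset_card_le => p [].
move=> [p /= /set_mem[[Bp Cp] _]]; apply: measurableX; rewrite lcsc_borel.
- by apply: sub_sigma_algebra; exact: bB.1.
- by apply: sub_sigma_algebra; exact: bC.1.
Qed.

HB.instance Definition _ := isLCSCGroup.Build _ (G * H)%type
  prod_mulg_continuous prod_invg_continuous prod_hausdorff
  prod_locally_compact prod_second_countable prod_borel.

End lcsc_group_prod.

(* A left Haar measure. Its sigma-finiteness, which the product measures below
   require, is carried by the type of [m], and regularity is not mentioned: both
   are automatic on a locally compact second countable group. *)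
Definition haar_measure d (G : lcscGroupType d) (R : realType)
    (m : {sigma_finite_measure set G -> \bar R}) : Prop :=
  [/\ forall (g : G) (A : set G), measurable A ->
        m ((fun x => g * x)%g @^-1` A) = m A,
      forall K : set G, compact K -> m K < +oo
    & 0 < m [set: G] ].

(* [X] is the Borel space of a Polish space. The structure
   [completePseudoMetricType] only has a pseudometric, which separates points
   exactly when the topology is Hausdorff. *)
Definition standard_borel (R : realType) d (X : measurableType d) : Prop :=
  exists (P : completePseudoMetricType R) (f : X -> P),
    [/\ hausdorff_space P, @second_countable P, bijective f
      & @measurable d X =
        preimage_set_system setT f <<s [set U : set P | open U] >> ].

(* The map [G * X -> X] is jointly Borel, while the action identities hold up to
   a null set, which may depend on the group elements. *)
Definition nonsingular_action dG (G : lcscGroupType dG) (R : realType)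
    d (X : measurableType d) (mu : probability X R) (act : G -> X -> X) : Prop :=
  [/\ standard_borel R X,
      measurable_fun setT (fun p : G * X => act p.1 p.2),
      {ae mu, forall x, act 1%g x = x},
      forall g h : G, {ae mu, forall x, act (g * h)%g x = act g (act h x)}
    & forall (g : G) (A : set X), measurable A ->
        mu (act g @^-1` A) = 0 <-> mu A = 0 ].

Definition cocycle dG (G : lcscGroupType dG) dH (H : lcscGroupType dH)
    (R : realType) d (X : measurableType d) (mu : probability X R)
    (act : G -> X -> X) (w : G -> X -> H) : Prop :=
  measurable_fun setT (fun p : G * X => w p.1 p.2) /\
  forall g h : G,
    {ae mu, forall x, w (g * h)%g x = (w g (act h x) * w h x)%g}.

(* An almost everywhere defined, measure class preserving Borel isomorphism: a
   total map whose values outside the conull Borel set [D] are irrelevant. *)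
Definition measure_class_iso dS (S : measurableType dS) dT
    (T : measurableType dT) (R : realType) (m : set S -> \bar R)
    (n : set T -> \bar R) (f : S -> T) : Prop :=
  exists (D : set S) (E : set T),
    [/\ measurable D /\ measurable E, m (~` D) = 0 /\ n (~` E) = 0,
        set_bij D E f,
        measurable_fun D f /\
        (forall A, measurable A -> A `<=` D -> measurable (f @` A))
      & forall A, measurable A -> A `<=` D -> m A = 0 <-> n (f @` A) = 0 ].

(* [phi : X * H -> Omega] identifies the action of [H] on [Omega] with the left
   translation action on the second factor. *)
Definition product_chart dH (H : lcscGroupType dH) (R : realType)
    (mH : {sigma_finite_measure set H -> \bar R})
    dO (Omega : measurableType dO) (eta : probability Omega R)
    (actH : H -> Omega -> Omega)
    d (X : measurableType d) (mu : probability X R)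
    (phi : X * H -> Omega) : Prop :=
  measure_class_iso (mu \x mH) eta phi /\
  forall h : H,
    {ae mu \x mH, forall p, phi (p.1, (h * p.2)%g) = actH h (phi p)}.

Definition left_factor (G H : groupType) (T : Type) (a : G * H -> T -> T) :
  G -> T -> T := fun g => a (g, 1%g).

Definition right_factor (G H : groupType) (T : Type) (a : G * H -> T -> T) :
  H -> T -> T := fun h => a (1%g, h).

Definition measure_correspondence dG (G : lcscGroupType dG)
    dH (H : lcscGroupType dH) (R : realType)
    (mG : {sigma_finite_measure set G -> \bar R})
    (mH : {sigma_finite_measure set H -> \bar R})
    dO (Omega : measurableType dO) (eta : probability Omega R)
    (a : G * H -> Omega -> Omega) : Prop :=
  [/\ nonsingular_action eta a,
      exists (d : measure_display) (X : measurableType d)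
        (mu : probability X R) (phi : X * H -> Omega),
        standard_borel R X /\ product_chart mH eta (right_factor a) mu phi
    & exists (d : measure_display) (Y : measurableType d)
        (nu : probability Y R) (psi : Y * G -> Omega),
        standard_borel R Y /\ product_chart mG eta (left_factor a) nu psi ].

(* [act] and [w] are the action and the cocycle associated with some choice of
   the chart [phi]. *)
Definition associated dG (G : lcscGroupType dG) dH (H : lcscGroupType dH)
    (R : realType) (mH : {sigma_finite_measure set H -> \bar R})
    dO (Omega : measurableType dO) (eta : probability Omega R)
    (actG : G -> Omega -> Omega) (actH : H -> Omega -> Omega)
    d (X : measurableType d) (mu : probability X R)
    (act : G -> X -> X) (w : G -> X -> H) : Prop :=
  [/\ nonsingular_action mu act, cocycle mu act w
    & exists2 phi : X * H -> Omega, product_chart mH eta actH mu phi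
      & forall g : G, {ae mu \x mH, forall p,
          actG g (phi p) = phi (act g p.1, (p.2 * (w g p.1)^-1)%g)} ].

Definition large_family (R : realType) d (X : measurableType d)
    (mu : probability X R) (F : set (set X)) : Prop :=
  [/\ F `<=` measurable,
      forall A B, F A -> F B -> F (A `|` B),
      forall A B, F A -> measurable B -> B `<=` A -> F B
    & forall e : R, (0 < e)%R -> exists2 A, F A & mu (~` A) < e%:E ].

Definition proper_cocycle dG (G : lcscGroupType dG) dH (H : lcscGroupType dH)
    (R : realType) d (X : measurableType d) (mu : probability X R)
    (act : G -> X -> X) (w : G -> X -> H) : Prop :=
  exists F : set (set X),
    [/\ large_family mu F,
        forall (K : set G) (A B : set X), compact K -> F A -> F B ->
          exists2 L : set H, precompact L
            & forall g, K g ->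
                {ae mu, forall x, A x -> B (act g x) -> L (w g x)}
      & forall (L : set H) (A B : set X), compact L -> F A -> F B ->
          precompact [set g : G |
            0 < mu [set x | [/\ A x, B (act g x) & L (w g x)] ] ] ].

(* Main.v *)
Require Import Defs.
From mathcomp Require Import all_boot all_order all_algebra.
From mathcomp Require Import all_classical all_reals all_analysis.

Set Implicit Arguments.
Unset Strict Implicit.
Unset Printing Implicit Defensive.

Import Order.TTheory GRing.Theory Num.Theory.
Local Open Scope classical_set_scope.
Local Open Scope ring_scope.
Local Open Scope ereal_scope.

(* Let [f : X -> S -> T] take values in a locally compact group [T] and let [S]
   carry a left Haar measure. The sets [A] on which the maps [f x], restricted
   to compact subsets of [S], are uniformly tight form a large family. If [x]
   and [y] range over two such sets and [u] over a compact set, then some [s],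
   outside any prescribed null set, puts [f x s] and [f y (u * s)] in a fixed
   compact set.

   With [f x s = omega s^-1 x], the cocycle identity reads
   [omega g x = (f (g x) (g * s))^-1 * f x s], which is condition (1) of
   properness and holds for every cocycle. For condition (2), let [gam] be the
   [G]-coordinate of [psi^-1 phi]; since [gam (g x) (h * (omega g x)^-1)] equals
   [g * gam x h], the map [f x h = gam x h^-1] satisfies
   [g = f (g x) (omega g x * h) * (f x h)^-1], so [g] is confined to a compact
   set as soon as [omega g x] is. *)

(** * Topology and Borel structure of locally compact second countable groups *)

Section lcsc_group_theory.
Context d (G : lcscGroupType d).

Lemma open_measurable_lcsc (U : set G) : open U -> measurable U.
Proof. by move=> oU; rewrite lcsc_borel; exact: sub_sigma_algebra. Qed.

Lemma closed_measurable_lcsc (A : set G) : closed A -> measurable A.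
Proof.
move=> cA; rewrite -[A]setCK; apply: measurableC.
by apply: open_measurable_lcsc; exact: closed_openC.
Qed.

Lemma compact_measurable_lcsc (K : set G) : compact K -> measurable K.
Proof.
by move=> cK; apply: closed_measurable_lcsc; exact: compact_closed lcsc_hausdorff cK.
Qed.

Lemma continuous_measurable_lcsc d' (H : lcscGroupType d') (f : G -> H) :
  continuous f -> measurable_fun setT f.
Proof.
move=> cf; apply: (@measurability _ _ _ _ _ _ [set A : set H | open A]).
  exact: lcsc_borel.
move=> _ [U oU <-].
by rewrite setTI; apply: open_measurable_lcsc; exact: open_comp oU.
Qed.

End lcsc_group_theory.

Section lcsc_group_measurability.
Context d (G : lcscGroupType d).

Lemma measurable_mulg_lcsc :
  measurable_fun [set: G * G] (fun p : G * G => p.1 * p.2)%g.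
Proof. by apply: continuous_measurable_lcsc; exact: mulg_continuous. Qed.

Lemma measurable_invg_lcsc : measurable_fun [set: G] (fun g : G => g^-1%g).
Proof. by apply: continuous_measurable_lcsc; exact: invg_continuous. Qed.

Lemma measurable_funMg d' (T : measurableType d') (f g : T -> G) :
  measurable_fun setT f -> measurable_fun setT g ->
  measurable_fun setT (fun t => f t * g t)%g.
Proof.
move=> mf mg.
apply: (measurableT_comp measurable_mulg_lcsc (measurable_fun_pair mf mg)).
Qed.

Lemma measurable_funVg d' (T : measurableType d') (f : T -> G) :
  measurable_fun setT f -> measurable_fun setT (fun t => (f t)^-1)%g.
Proof. by move=> mf; exact: (measurableT_comp measurable_invg_lcsc mf). Qed.

Lemma measurable_eq_lcsc d' (T : measurableType d') (f g : T -> G) :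
  measurable_fun setT f -> measurable_fun setT g ->
  measurable [set t | f t = g t].
Proof.
move=> mf mg.
have -> : [set t | f t = g t] =
    setT `&` (fun t => (f t)^-1 * g t)%g @^-1` [set 1%g].
  rewrite setTI; apply/seteqP; split=> t /=; first by move=> ->; rewrite mulVg.
  by move/(congr1 (fun x => (f t * x)%g)); rewrite mulVKg mulg1.
have m := measurable_funMg (measurable_funVg mf) mg.
apply: (m measurableT); apply: closed_measurable_lcsc.
apply: accessible_closed_set1; apply: hausdorff_accessible; exact: lcsc_hausdorff.
Qed.

Lemma compactMg (K L : set G) : compact K -> compact L ->
  compact [set (x * y)%g | x in K & y in L].
Proof.
move=> cK cL.
have -> : [set (x * y)%g | x in K & y in L] =
    (fun p : G * G => (p.1 * p.2)%g) @` (K `*` L); last first.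
  apply: continuous_compact; last exact: compact_setX.
  by apply: continuous_subspaceT; exact: mulg_continuous.
apply/seteqP; split=> [_ [x Kx [y Ly <-]]|_ [[x y] [Kx Ly] <-]].
- by exists (x, y).
- by exists x => //; exists y.
Qed.

Lemma compactVg (K : set G) : compact K -> compact ((fun x => x^-1)%g @` K).
Proof.
move=> cK; apply: continuous_compact => //.
by apply: continuous_subspaceT; exact: invg_continuous.
Qed.

(** By local compactness the basic open sets contained in a compact set cover [G], and second
    countability leaves countably many of them. Finite unions of compact sets around them are
    cofinal, by finite subcovers. *)
Lemma lcsc_compact_exhaustion : exists C : (set G)^nat,
  [/\ forall n, compact (C n), nondecreasing_seq C
    & forall K, compact K -> exists n, K `<=` C n].
Proof.
have [B cB bB] := @lcsc_second_countable _ G.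
pose B' := [set U | B U /\ exists2 K, compact K & U `<=` K].
have /countable_injP[f f_inj] : countable B'.
  by apply: sub_countable cB; apply: subset_card_le => U [].
(* [f] codes [B'] injectively by naturals, so [k i] is a compact set containing the basic set with
   code [i], or [set0] if no set has that code. *)
pose P i := [set K : set G | compact K /\
  exists U, [/\ B' U, f U = i & U `<=` K]].
pose k i := xget set0 (P i).
have ck i : compact (k i).
  by rewrite /k; case: xgetP => [K _ []//|_]; exact: compact0.
have Uk U : B' U -> U `<=` k (f U).
  move=> B'U; have [BU [K cK UK]] := B'U.
  have PK : P (f U) K by split => //; exists U.
  have [_ [V [B'V fVU Vk]]] := xgetPex set0 (ex_intro _ K PK).
  have VU : V = U by apply: f_inj fVU; apply/mem_set.
  by rewrite -VU in Vk *.
exists (fun n => \big[setU/set0]_(i < n) k i); split.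
- by move=> n; exact: bigsetU_compact.
- move=> m n mn; apply/subsetPset; rewrite -!bigcup_mkord => x [i im kx].
  by exists i => //=; exact: leq_trans mn.
- move=> K; rewrite compact_cover => Kcov.
  pose g i := \bigcup_(U in [set U | B' U /\ f U = i]) U.
  have gk i : g i `<=` k i by move=> x [U [B'U <-] Ux]; exact: Uk Ux.
  have [i _|x _|D _ KD] := Kcov nat setT g.
  + by apply: bigcup_open => U [[BU _] _]; exact: bB.1.
  + have [K' nK' [cK' _]] := lcsc_locally_compact x Logic.I.
    rewrite withinET in nK'.
    have [U [BU Ux] UK'] := bB.2 x K' nK'.
    by exists (f U) => //; exists U => //; split=> //; split=> //; exists K'.
  (* The [n]-th union runs over [i < n], hence the successor of the largest index of the
     subcover. *)
  + exists (\max_(i <- finmap.enum_fset D) i).+1 => x /KD[i Di gix].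
    rewrite -bigcup_mkord; exists i => /=; last exact: gk.
    by rewrite ltnS; exact: (@leq_bigmax_seq _ _ xpredT (fun i => i)).
Qed.

End lcsc_group_measurability.

(** * Null sets of product measures and null-preserving maps *)

Section null_sets_of_products.
Context (R : realType) d1 d2 (T1 : measurableType d1) (T2 : measurableType d2).
Variables (m1 : {sigma_finite_measure set T1 -> \bar R})
  (m2 : {sigma_finite_measure set T2 -> \bar R}).

Lemma ae_xsection (P : set (T1 * T2)) :
  {ae m1 \x m2, forall p, P p} ->
  {ae m1, forall x, {ae m2, forall y, P (x, y)}}.
Proof.
move=> [N [mN N0 PN]].
(* Tonelli: the measures of the sections are nonnegative with zero integral, hence vanish almost
   everywhere. *)
have : ae_eq m1 setT (m2 \o xsection N) (cst 0).
  apply/ae_eq_integral_abs => //; first exact: measurable_fun_xsection.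
  rewrite -[RHS]N0; apply: eq_integral => x _.
  by rewrite gee0_abs.
apply: filterS => x /(_ Logic.I) /= Nx0.
exists (xsection N x); split => //; first exact: measurable_xsection.
by move=> y Py; rewrite /xsection/= inE; exact: PN.
Qed.

Lemma product_measure_eq0_xsection (N : set (T1 * T2)) : measurable N ->
  {ae m1, forall x, m2 (xsection N x) = 0} -> (m1 \x m2) N = 0.
Proof.
move=> mN N0.
have <- : \int[m1]_x `|(m2 \o xsection N) x| = (m1 \x m2) N.
  by apply: eq_integral => x _; rewrite gee0_abs.
apply/ae_eq_integral_abs => //; first exact: measurable_fun_xsection.
exact: filterS N0.
Qed.

(** [\x] integrates the measures of the [x]-sections; uniqueness of the product measure allows
    integrating those of the [y]-sections instead. *)
Lemma product_measure_eq0_ysection (N : set (T1 * T2)) : measurable N ->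
  (forall y, m1 (ysection N y) = 0) -> (m1 \x m2) N = 0.
Proof.
move=> mN N0.
rewrite (@product_measure_unique _ _ _ _ _ m1 m2 (m1 \x^ m2))//; last first.
  by move=> A B mA mB; exact: product_measure2E.
by rewrite [LHS]integral0_eq// => y _; exact: N0.
Qed.

End null_sets_of_products.

(** Nonsingularity in the direction that pulls almost everywhere statements back along [f]. *)
Definition null_preserving d (T : measurableType d) (R : realType)
    (m : set T -> \bar R) (f : T -> T) : Prop :=
  measurable_fun setT f /\
  forall A, measurable A -> m A = 0 -> m (f @^-1` A) = 0.

Lemma ae_null_preserving d (T : measurableType d) (R : realType)
    (m : set T -> \bar R) (f : T -> T) (P : set T) :
  null_preserving m f -> {ae m, forall x, P x} -> {ae m, forall x, P (f x)}.
Proof.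
move=> [mf f0] [N [mN N0 PN]]; exists (f @^-1` N); split; last 2 first.
- exact: f0.
- by move=> x Px; exact: PN.
- by rewrite -[X in measurable X]setTI; exact: mf.
Qed.

Lemma null_preserving_skew_product (R : realType) d1 d2
    (T1 : measurableType d1) (T2 : measurableType d2)
    (m1 : {sigma_finite_measure set T1 -> \bar R})
    (m2 : {sigma_finite_measure set T2 -> \bar R})
    (f : T1 -> T1) (r : T1 -> T2 -> T2) :
  measurable_fun setT (fun p : T1 * T2 => r p.1 p.2) ->
  null_preserving m1 f -> (forall x, null_preserving m2 (r x)) ->
  null_preserving (m1 \x m2) (fun p => (f p.1, r p.1 p.2)).
Proof.
move=> mr nf nr; set s := fun p => _.
have ms : measurable_fun setT s.
  apply: measurable_fun_pair => //; exact: measurableT_comp nf.1 measurable_fst.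
split=> // N mN N0.
have mN' : measurable (s @^-1` N) by rewrite -[X in measurable X]setTI; exact: ms.
apply: product_measure_eq0_xsection => //.
have /ae_xsection/(ae_null_preserving nf) : {ae m1 \x m2, forall p, ~ N p}.
  by exists N; split => // p /=; exact: contrapT.
apply: filterS => x /= /(ae_null_preserving (nr x)) Nx.
apply/(negligibleP m2); first exact: measurable_xsection.
by apply: negligibleS Nx => y; rewrite /xsection/= inE => ? /(_ _).
Qed.

(** * Invariance of Haar null sets under inversion and translations *)

Section haar_null_sets.
Context (R : realType) d (G : lcscGroupType d).
Variable m : {sigma_finite_measure set G -> \bar R}.
Hypothesis haar_m : haar_measure m.

Lemma haar_null_preserving_mull (g : G) : null_preserving m (fun x => g * x)%g.
Proof.
have [ml _ _] := haar_m; split=> [|A mA A0]; last by rewrite ml.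
exact: measurable_funMg.
Qed.

(* Fubini for [{(s, t) | s^-1 * t \in A}]: its sections are the left translates
   [s * A] and [t * A^-1]. *)
Lemma haar_null_preserving_inv : null_preserving m (fun x : G => x^-1)%g.
Proof.
have [ml _ mT] := haar_m; split=> [|A mA A0]; first exact: measurable_invg_lcsc.
pose N := [set p : G * G | A (p.2^-1 * p.1)%g].
have mN : measurable N.
  rewrite -[N]setTI; apply: (@measurable_funMg _ G) => //.
  exact: measurable_funVg.
have N0 : (m \x m) N = 0.
  apply: product_measure_eq0_ysection => // t.
  rewrite -(ml t^-1%g A mA) in A0.
  by rewrite -[RHS]A0; congr (m _); apply/seteqP; split=> s; rewrite /ysection/= inE.
have /ae_xsection aeN : {ae m \x m, forall p, ~ N p}.
  by exists N; split => // p /=; exact: contrapT.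
(* As [m] is nonzero, some [x] has a null section; this section is [x * A^-1], which has the measure
   of [A^-1]. *)
have [|x Nx] := @filter_ex _ _ (ae_properfilter_algebraOfSetsType _) _ aeN.
  exact: mT.
have mA' : measurable ((fun x : G => x^-1)%g @^-1` A).
  by rewrite -[X in measurable X]setTI; exact: measurable_invg_lcsc.
rewrite -(ml x^-1%g)//.
apply/(negligibleP m).
  rewrite -[X in measurable X]setTI; exact: (haar_null_preserving_mull _).1.
by apply: negligibleS Nx => t /=; rewrite invgM invgK /N /= => ? /(_ _).
Qed.

(** Right translation by [h] is left translation by [h^-1] conjugated by inversion. *)
Lemma haar_null_preserving_mulr (h : G) : null_preserving m (fun x => x * h)%g.
Proof.
split=> [|A mA A0]; first exact: measurable_funMg.
have -> : (fun x => x * h)%g @^-1` A = (fun x => x^-1)%g @^-1`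
    ((fun x => h^-1 * x)%g @^-1` ((fun x => x^-1)%g @^-1` A)).
  by apply/seteqP; split => x /=; rewrite invgM !invgK.
have [mi i0] := haar_null_preserving_inv.
have [ml l0] := haar_null_preserving_mull h^-1%g.
have mA' : measurable ((fun x : G => x^-1)%g @^-1` A).
  by rewrite -[X in measurable X]setTI; exact: mi.
apply: (i0); first by rewrite -[X in measurable X]setTI; exact: ml.
by apply: l0 => //; exact: i0.
Qed.

End haar_null_sets.

(** * Large families and uniform tightness *)

Lemma measure_nonincreasing_lt d (T : measurableType d) (R : realType)
    (m : {measure set T -> \bar R}) (F : (set T)^nat) (e : \bar R) :
  m (F 0%N) < +oo -> (forall i, measurable (F i)) -> nonincreasing_seq F ->
  \bigcap_n F n = set0 -> 0 < e -> exists n, m (F n) < e.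
Proof.
move=> F0 mF ndF capF e0.
have : m \o F @ \oo --> 0.
  by rewrite -(measure0 m) -capF; apply: nonincreasing_cvg_mu; rewrite ?capF.
move=> /(_ _ (open_ereal_lt' e0)) [n _ /(_ n (leqnn n))] Fn.
by exists n.
Qed.

(** Members of the two families with complements below [e / 2] have an intersection that lies in
    both, by closure under Borel subsets. This lets a single family serve both conditions of
    properness. *)
Lemma large_familyI (R : realType) d (X : measurableType d)
    (mu : probability X R) (F1 F2 : set (set X)) :
  large_family mu F1 -> large_family mu F2 -> large_family mu (F1 `&` F2).
Proof.
move=> [m1 U1 S1 E1] [m2 U2 S2 E2]; split.
- by move=> A [/m1].
- by move=> A B [? ?] [? ?]; split; [exact: U1|exact: U2].
- by move=> A B [? ?] mB BA; split; [exact: S1 BA|exact: S2 BA].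
- move=> e e0; have e20 : (0 < e / 2)%R by rewrite divr_gt0.
  have [A1 FA1 lt1] := E1 _ e20; have [A2 FA2 lt2] := E2 _ e20.
  have mA1 := m1 _ FA1; have mA2 := m2 _ FA2.
  exists (A1 `&` A2).
    by split; [apply: S1 FA1 _ _|apply: S2 FA2 _ _] => //; exact: measurableI.
  rewrite setCI; apply: le_lt_trans (measureU2 _ _ _) _; try exact: measurableC.
  by rewrite [e]splitr EFinD lteD.
Qed.

Section tight_family.
Context (R : realType) dX (X : measurableType dX).
Context dS (S : lcscGroupType dS) dT (T : lcscGroupType dT).
Variable m : {sigma_finite_measure set S -> \bar R}.
Hypothesis haar_m : haar_measure m.
Variable f : X -> S -> T.
Hypothesis mf : measurable_fun setT (fun p : X * S => f p.1 p.2).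

Let escape (C : set S) (L : set T) (x : X) := [set s | C s /\ ~ L (f x s)].

Let escape_xsection C L x :
  escape C L x = xsection [set p : X * S | C p.2 /\ ~ L (f p.1 p.2)] x.
Proof. by apply/seteqP; split=> s; rewrite /xsection/= inE. Qed.

Let measurable_escapes (C : set S) (L : set T) : compact C -> compact L ->
  measurable [set p : X * S | C p.2 /\ ~ L (f p.1 p.2)].
Proof.
move=> cC cL; apply: measurableI.
- rewrite -[X in measurable X]setTI; apply: measurable_snd => //.
  exact: compact_measurable_lcsc.
- rewrite -[X in measurable X]setTI; apply: (mf measurableT (Y := ~` L)).
  by apply: measurableC; exact: compact_measurable_lcsc.
Qed.

Let measurable_escape C L x : compact C -> compact L -> measurable (escape C L x).
Proof.
move=> cC cL; rewrite escape_xsection; apply: measurable_xsection.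
exact: measurable_escapes.
Qed.

Definition tight_family : set (set X) := [set A | measurable A /\
  forall (C : set S) (e : R), compact C -> (0 < e)%R ->
    exists2 L : set T, compact L & forall x, A x ->
      m [set s | C s /\ ~ L (f x s)] < e%:E].

(** With compact exhaustions of [S] and [T], tightness reduces to countably many conditions, one for
    each [n]. Each holds off a set of small [mu]-measure once the compact set in [T] is large
    enough, and these exceptional measures are made summable. *)
Lemma tight_family_large (mu : probability X R) : large_family mu tight_family.
Proof.
have mS : {homo m : A B / measurable A /\ measurable B /\ A `<=` B >-> A <= B}.
  by move=> A B [mA [mB AB]]; apply: le_measure; rewrite ?inE.
split.
- by move=> A [].
- move=> A B [mA tA] [mB tB]; split=> [|C e cC e0]; first exact: measurableU.
  have [L cL AL] := tA C e cC e0; have [L' cL' BL'] := tB C e cC e0.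
  have cLL' := compactU cL cL'.
  exists (L `|` L') => // x [/AL|/BL']; apply: le_lt_trans; apply: mS;
    split; [exact: measurable_escape|split; first exact: measurable_escape|
            exact: measurable_escape|split; first exact: measurable_escape].
  + by move=> s [Cs nL]; split=> // Ls; apply: nL; left.
  + by move=> s [Cs nL]; split=> // Ls; apply: nL; right.
- move=> A B [mA tA] mB BA; split=> // C e cC e0.
  by have [L cL AL] := tA C e cC e0; exists L => // x /BA; exact: AL.
move=> e e0.
have [C [cC ndC Ccof]] := lcsc_compact_exhaustion S.
have [L [cL ndL Lcof]] := lcsc_compact_exhaustion T.
pose E n k := [set x | m (escape (C n) (L k) x) < (n.+1%:R^-1)%:E].
have mE n k : measurable (E n k).
  rewrite -[E n k]setTI; apply: measurable_lte => //.
  under [X in measurable_fun _ X]eq_fun do rewrite escape_xsection.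
  by apply: measurable_fun_xsection; exact: measurable_escapes.
have /choice[k kP] : forall n, exists k,
    mu (~` E n k) < (e / 2 / (2 ^ n.+1)%:R)%:E.
  move=> n; apply: measure_nonincreasing_lt.
  - exact: le_lt_trans (probability_le1 _ (measurableC (mE _ _))) (ltry _).
  - by move=> k; exact: measurableC.
  - move=> i j ij; apply/subsetPset; apply: subsetC => x; apply: le_lt_trans.
    apply: mS; split; first exact: measurable_escape.
    split; first exact: measurable_escape.
    move=> s [Cs nL]; split=> // Ls; apply: nL.
    by move: Ls; exact/subsetPset/ndL.
  - apply/seteqP; split=> // x nE.
    (* For fixed [x] the escape sets decrease to the empty set inside [C n], which has finite Haar
       measure, because the [L k] exhaust [T]. So [x] lies in some [E n k]. *)
    have [|||||k Ek] := @measure_nonincreasing_lt _ _ _ m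
        (fun k => escape (C n) (L k) x) (n.+1%:R^-1)%:E.
    + have [_ + _] := haar_m => /(_ _ (cC n)); apply: le_lt_trans; apply: mS.
      split; first exact: measurable_escape.
      by split=> [|s []//]; exact: compact_measurable_lcsc.
    + by move=> k; exact: measurable_escape.
    + move=> i j ij; apply/subsetPset => s [Cs nL]; split=> // Ls; apply: nL.
      by move: Ls; exact/subsetPset/ndL.
    + apply/seteqP; split=> // s sP.
      have [k sk] := Lcof _ (@compact_set1 _ (f x s)).
      by have [_] := sP k Logic.I; apply; exact: sk.
    + by rewrite lte_fin invr_gt0.
    + by apply: (nE k Logic.I).
  - by rewrite lte_fin !divr_gt0// ltr0n expn_gt0.
exists (\bigcap_n E n (k n)).
  split=> [|K e' cK e'0]; first exact: bigcap_measurableType.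
  have [n0 Kn0] := Ccof K cK.
  have [n1 _ /(_ n1 (leqnn _)) n1e] := near_infty_natSinv_lt (PosNum e'0).
  (* [n0] puts [K] inside [C n], and [n1] makes [n.+1%:R^-1] smaller than [e']. *)
  pose n := maxn n0 n1.
  exists (L (k n)) => // x /(_ n Logic.I) Ex.
  apply: le_lt_trans (lt_trans Ex _); last first.
    rewrite lte_fin; apply: le_lt_trans n1e.
    by rewrite lef_pV2 ?posrE// ler_nat ltnS leq_maxr.
  apply: mS; split; first exact: measurable_escape.
  split; first exact: measurable_escape.
  move=> s [/Kn0 Ks nL]; split=> //; move: Ks; apply/subsetPset/ndC.
  exact: leq_maxl.
have e2 : (0 <= e / 2)%R by rewrite divr_ge0// ltW.
(* The bounds in [kP] sum to at most [e / 2], which leaves room for the strict inequality. *)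
rewrite setC_bigcap; apply: (@le_lt_trans _ _ (e / 2)%:E); last first.
  by rewrite lte_fin ltr_pdivrMr// ltr_pMr// ltr1n.
apply: le_trans _ (epsilon_trick0 xpredT e2).
apply: le_trans (@measure_sigma_subadditive _ _ _ mu _ _ _ _ (@subset_refl _ _)) _.
- by move=> n; exact: measurableC.
- by apply: bigcup_measurable => n _; exact: measurableC.
- by apply: lee_nneseries => // n _; exact: ltW (kP n).
Qed.

(** [S] is sigma-compact, so if every compact set were null, the whole group would be. *)
Lemma haar_compact_gt0 : exists2 C : set S, compact C & 0 < m C.
Proof.
have [C [cC _ Ccof]] := lcsc_compact_exhaustion S.
have [_ _ mT] := haar_m; apply: contrapT => nC; move: mT.
have -> : [set: S] = \bigcup_n C n.
  apply/seteqP; split=> // s _.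
  by have [n sn] := Ccof _ (@compact_set1 _ s); exists n => //; exact: sn.
rewrite measure_gt0 => /eqP; apply; apply: measure_negligible.
  by apply: bigcup_measurable => n _; exact: compact_measurable_lcsc.
apply: negligible_bigcup => n.
apply/negligibleP; first exact: compact_measurable_lcsc.
apply/eqP; rewrite -[_ == _]negbK -measure_gt0.
by apply/negP => Cn; apply: nC; exists (C n).
Qed.

(* In a compact set of positive measure, the [s] with [f x s] outside a large
   compact set and those with [f y (u * s)] outside it each have measure less
   than half, the latter by left invariance. *)
Lemma tight_family_meet (A B : set X) (U : set S) :
  tight_family A -> tight_family B -> compact U ->
  exists2 L : set T, compact L & forall x y u (N : set S),
    A x -> B y -> U u -> m.-negligible N ->
    exists s, [/\ ~ N s, L (f x s) & L (f y (u * s)%g)].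
Proof.
move=> [mA tA] [mB tB] cU; have [ml mc _] := haar_m.
have [C cC C0] := haar_compact_gt0.
have mC := compact_measurable_lcsc cC.
have Cfin : m C \is a fin_num by rewrite ge0_fin_numE// mc.
pose e := (fine (m C) / 2)%R.
have e0 : (0 < e)%R by rewrite divr_gt0// fine_gt0// C0 mc.
(* For [s] in [C] the product [u * s] stays in [U * C], so the tightness of [B] is applied there. *)
have cUC := compactMg cU cC.
have [L cL AL] := tA C e cC e0; have [L' cL' BL'] := tB _ e cUC e0.
exists (L `|` L'); first exact: compactU.
move=> x y u N Ax By Uu [N' [mN' N'0 NN']]; apply: contrapT => nex.
have {}AL := AL x Ax; have {}BL' := BL' y By.
set E1 := mkset _ in AL; set E2 := mkset _ in BL'.
have mE1 : measurable E1 by exact: measurable_escape.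
have mE2 : measurable E2 by exact: measurable_escape.
pose E3 := (fun s => u * s)%g @^-1` E2.
have mE3 : measurable E3.
  rewrite -[E3]setTI; exact: (haar_null_preserving_mull haar_m u).1.
(* If no [s] worked, these three sets would cover [C], although their measures add up to less than
   [m C]. *)
have : m C <= m (N' `|` E1 `|` E3).
  apply: le_measure; rewrite ?inE//; first by apply: measurableU => //; exact: measurableU.
  move=> s Cs; apply: contrapT => /not_orP[/not_orP[nN nE1] nE3]; apply: nex.
  exists s; split; first by move/NN'.
  - by left; apply: contrapT => nL; apply: nE1.
  - right; apply: contrapT => nL; apply: nE3; split => //.
    by exists u => //; exists s.
apply/negP; rewrite -ltNge.
apply: le_lt_trans (measureU2 _ _ _) _ => //; first exact: measurableU.
rewrite [X in m X + _]setUC measureU0//.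
rewrite -(fineK Cfin) [fine _]splitr EFinD; apply: lteD => //.
by move: BL'; rewrite -(ml u E2 mE2).
Qed.

End tight_family.

(** * The group coordinate read through a second chart *)

(* The witness is the [G]-coordinate of [psi^-1 (phi p)], extended by [1]. *)
Lemma chart_coordinate (R : realType) dS (S : measurableType dS)
    (m : {measure set S -> \bar R}) dO (Omega : measurableType dO)
    (eta : probability Omega R) (phi : S -> Omega)
    dG (G : lcscGroupType dG) (mG : {sigma_finite_measure set G -> \bar R})
    (actG : G -> Omega -> Omega) dY (Y : measurableType dY)
    (nu : probability Y R) (psi : Y * G -> Omega) :
  haar_measure mG -> measure_class_iso m eta phi ->
  product_chart mG eta actG nu psi ->
  exists gam : S -> G, measurable_fun setT gam /\
    forall (g : G) (tau : S -> S), null_preserving m tau ->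
      {ae m, forall p, actG g (phi p) = phi (tau p)} ->
      {ae m, forall p, gam (tau p) = (g * gam p)%g}.
Proof.
move=> haar_m [D1 [E1 [[mD1 mE1] [D10 _] [phiDE _ _] [mphi phi_im] phi0]]].
move=> [[D2 [E2 [[mD2 mE2] [D20 E20] [_ psi_inj psi_surj] [_ psi_im] psi0]]] psiG].
(* The preimage of [V] under the partial map [psi^-1 phi], written through images under [psi] so
   that its measurability follows from [psi_im]. *)
pose W V := D1 `&` phi @^-1` (psi @` (D2 `&` V)).
have mpsi V : measurable V -> measurable (psi @` (D2 `&` V)).
  by move=> mV; apply: psi_im; [exact: measurableI|exact: subIsetl].
have mW V : measurable V -> measurable (W V).
  by move=> mV; apply: mphi => //; exact: mpsi.
(* [phi0] compares a set with its image; the image of this preimage lies inside [V]. *)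
have phi_null V : measurable V -> eta V = 0 -> m (D1 `&` phi @^-1` V) = 0.
  move=> mV V0; have mA : measurable (D1 `&` phi @^-1` V) by exact: mphi.
  apply/(phi0 _ mA (@subIsetl _ _ _)); apply: measure_negligible.
  + by apply: phi_im => //; exact: subIsetl.
  + exists V; split=> //; by move=> _ [p [_ Vp] <-].
pose Q p := [set k | D1 p /\ exists2 y, D2 (y, k) & psi (y, k) = phi p].
pose gam p := xget 1%g (Q p).
have gamE p k : Q p k -> gam p = k.
  move=> Qk; have [_ [y Dy yp]] := xgetPex 1%g (ex_intro _ k Qk).
  have [_ [y' Dy' yp']] := Qk.
  have /(psi_inj _ _ (mem_set Dy) (mem_set Dy'))[_] : psi (y, gam p) = psi (y', k).
    by rewrite yp yp'.
  exact.
exists gam; split.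
  move=> _ M mM; rewrite setTI.
  have mM' : measurable (setT `*` M : set (Y * G)) by exact: measurableX.
  (* Off [W setT] no [k] satisfies [Q p], so [gam] takes its default value 1 there. *)
  have -> : gam @^-1` M =
      W (setT `*` M) `|` (~` W setT `&` [set _ | M 1%g]).
    apply/seteqP; split=> p /=.
    - have [[k Qk]|nQ] := pselect (exists k, Q p k).
        rewrite (gamE _ _ Qk) => Mk; left; have [Dp [y Dy yp]] := Qk.
        by split=> //; exists (y, k).
      rewrite /gam; case: xgetP => [k _ Qk|_ M1]; first by case: nQ; exists k.
      right; split=> // -[Dp [[y k] [Dy _] yp]]; apply: nQ; exists k.
      by split=> //; exists y.
    - move=> [[Dp [[y k] [Dy [_ Mk]] yp]]|[nW M1]].
        by rewrite (gamE _ k)//; split=> //; exists y.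
      rewrite /gam; case: xgetP => // k _ [Dp [y Dy yp]]; case: nW.
      by split=> //; exists (y, k).
  apply: measurableU; first exact: mW.
  apply: measurableI; first exact/measurableC/mW.
  have [M1|nM1] := pselect (M 1%g).
    by rewrite (_ : [set _ | _] = setT)//; apply/seteqP; split.
  by rewrite (_ : [set _ | _] = set0)//; apply/seteqP; split.
move=> g tau ntau tauE.
have aeD1 : {ae m, forall p, D1 p} by exists (~` D1); split=> //; exact: measurableC.
have aeD2 : {ae nu \x mG, forall q, D2 q}.
  by exists (~` D2); split=> //; exact: measurableC.
have ng : null_preserving (nu \x mG) (fun q : Y * G => (q.1, g * q.2)%g).
  apply: (@null_preserving_skew_product _ _ _ _ _ _ _ id (fun _ k => g * k)%g).
  - exact: measurable_funMg.
  - by split.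
  - by move=> _; exact: haar_null_preserving_mull.
have [N [mN N0 NP]] : {ae nu \x mG, forall q : Y * G, D2 (q.1, g * q.2)%g /\
    psi (q.1, g * q.2)%g = actG g (psi q)}.
  exact: filterI (ae_null_preserving ng aeD2) (psiG g).
have aeE2 : {ae m, forall p, D1 p -> E2 (phi p)}.
  exists (D1 `&` phi @^-1` (~` E2)); split.
  - by apply: mphi => //; exact: measurableC.
  - by apply: phi_null => //; exact: measurableC.
  - by move=> p /not_implyP.
(* [psi] carries null subsets of [D2] to null sets, which [phi] pulls back to null sets. *)
have aeN : {ae m, forall p, ~ W N p}.
  exists (W N); split; [exact: mW| |by move=> p /contrapT].
  apply: phi_null; first exact: mpsi.
  apply/(psi0 _ _ (@subIsetl _ _ _)); first exact: measurableI.
  apply: measure_negligible; first exact: measurableI.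
  by exists N; split => // p [].
have aeD1tau := ae_null_preserving ntau aeD1.
have : {ae m, forall p, (D1 p /\ (D1 p -> E2 (phi p))) /\
    ((~ W N p /\ D1 (tau p)) /\ actG g (phi p) = phi (tau p))}.
  exact: filterI (filterI aeD1 aeE2) (filterI (filterI aeN aeD1tau) tauE).
apply: filterS => p [[Dp /(_ Dp) E2p] [[nWp Dtp] taup]].
(* If [(y, k)] are the coordinates of [phi p], those of [phi (tau p)] are [(y, g * k)]. *)
have [[y k] Dy yp] := psi_surj _ E2p.
have [Dgy gyE] : D2 (y, g * k)%g /\ psi (y, g * k)%g = actG g (psi (y, k)).
  apply: contrapT => nyk; apply: nWp; split=> //; exists (y, k) => //.
  by split=> //; apply: NP.
rewrite (gamE p k); last by split=> //; exists y.
by apply: gamE; split=> //; exists y => //; rewrite gyE yp.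
Qed.

(** * Properness of an associated cocycle *)

Section associated_proper.
Context (R : realType) dG (G : lcscGroupType dG) dH (H : lcscGroupType dH).
Variables (mG : {sigma_finite_measure set G -> \bar R})
  (mH : {sigma_finite_measure set H -> \bar R}).
Hypotheses (haarG : haar_measure mG) (haarH : haar_measure mH).
Context dX (X : measurableType dX) (mu : probability X R).
Variables (act : G -> X -> X) (w : G -> X -> H).
Hypotheses (nsact : nonsingular_action mu act) (cw : cocycle mu act w).

Let mw : measurable_fun setT (fun p : G * X => w p.1 p.2).
Proof. by case: cw. Qed.

Let mw_comp d (Z : measurableType d) (a : Z -> G) (b : Z -> X) :
  measurable_fun setT a -> measurable_fun setT b ->
  measurable_fun setT (fun z => w (a z) (b z)).
Proof.
by move=> ma mb; exact: (measurableT_comp mw (measurable_fun_pair ma mb)).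
Qed.

Let mw1 g : measurable_fun setT (w g).
Proof. exact: (measurable_fun_pair2 g mw). Qed.

Lemma nonsingular_action_null_preserving g : null_preserving mu (act g).
Proof.
have [_ mact _ _ act0] := nsact; split; first exact: (measurable_fun_pair2 g mact).
by move=> A mA /(act0 g A mA).
Qed.

Lemma measurable_cocycle_inv :
  measurable_fun setT (fun p : X * G => w p.2^-1%g p.1).
Proof.
by apply: mw_comp => //; exact: measurable_funVg.
Qed.

(** This is the cocycle identity for the product [(g * s)^-1 * g = s^-1]. It holds for each [s] at
    almost every [x], and Fubini exchanges the two quantifiers. *)
Lemma cocycle_inv_translate g : {ae mu, forall x, {ae mG, forall s,
  w s^-1%g x = (w (g * s)^-1 (act g x) * w g x)%g}}.
Proof.
have [mact _] := nonsingular_action_null_preserving g.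
pose N := [set p : X * G |
  w p.2^-1%g p.1 = (w (g * p.2)^-1 (act g p.1) * w g p.1)%g].
have mN : measurable N.
  apply: measurable_eq_lcsc; first exact: measurable_cocycle_inv.
  apply: measurable_funMg; last exact: measurableT_comp.
  apply: mw_comp.
    by apply: measurable_funVg; exact: measurable_funMg.
  exact: measurableT_comp.
suff : {ae mu \x mG, forall p, N p} by exact: ae_xsection.
exists (~` N); split=> //; first exact: measurableC.
apply: product_measure_eq0_ysection; first exact: measurableC.
move=> s; apply: measure_negligible.
  by apply: measurable_ysection; exact: measurableC.
have := cw.2 (g * s)^-1%g g; apply: negligibleS => x.
by rewrite /ysection/= inE /N /= => nN; rewrite invgM -mulgA mulVg mulg1 -invgM.
Qed.

(** Only one action on [Omega] and the two charts enter, so exchanging [G] and [H] yields the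
    statement for the other cocycle. *)
Lemma associated_proper dO (Omega : measurableType dO)
    (eta : probability Omega R) (actG : G -> Omega -> Omega)
    (phi : X * H -> Omega)
    dY (Y : measurableType dY) (nu : probability Y R) (psi : Y * G -> Omega) :
  measure_class_iso (mu \x mH) eta phi ->
  (forall g : G, {ae mu \x mH, forall p,
    actG g (phi p) = phi (act g p.1, (p.2 * (w g p.1)^-1)%g)}) ->
  product_chart mG eta actG nu psi ->
  proper_cocycle mu act w.
Proof.
move=> phi_iso phiG psi_chart.
have [gam [mgam gamG]] := chart_coordinate haarG phi_iso psi_chart.
pose f1 x s := w s^-1%g x.
(* The inverse turns right multiplication by [(w g x)^-1] into left translation by [w g x], the form
   that [tight_family_meet] handles. *)
pose f2 x h := gam (x, h^-1%g).
have mf1 : measurable_fun setT (fun p : X * G => f1 p.1 p.2).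
  exact: measurable_cocycle_inv.
have mf2 : measurable_fun setT (fun p : X * H => f2 p.1 p.2).
  apply: (measurableT_comp mgam (measurable_fun_pair _ _)) => //.
  exact: measurable_funVg.
have f2G g : {ae mu, forall x, {ae mH, forall h,
    f2 (act g x) (w g x * h)%g = (g * f2 x h)%g}}.
  apply: (@ae_xsection _ _ _ _ _ _ _ [set p | f2 (act g p.1) (w g p.1 * p.2)%g
    = (g * f2 p.1 p.2)%g]).
  have ntau : null_preserving (mu \x mH)
      (fun p => (act g p.1, (p.2 * (w g p.1)^-1)%g)).
    apply: (@null_preserving_skew_product _ _ _ _ _ _ _ _
      (fun x h => h * (w g x)^-1)%g).
    - apply: measurable_funMg => //; apply: measurable_funVg.
      exact: measurableT_comp.
    - exact: nonsingular_action_null_preserving.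
    - by move=> x; exact: haar_null_preserving_mulr.
  have ninv : null_preserving (mu \x mH) (fun p => (p.1, p.2^-1%g)).
    apply: (@null_preserving_skew_product _ _ _ _ _ _ _ id
      (fun _ h => h^-1)%g).
    - exact: measurable_funVg.
    - by split.
    - by move=> _; exact: haar_null_preserving_inv.
  apply: filterS (ae_null_preserving ninv (gamG g _ ntau (phiG g))) => p /=.
  by rewrite /f2 invgM.
exists (tight_family mG f1 `&` tight_family mH f2); split.
- by apply: large_familyI; exact: tight_family_large.
- move=> K A B cK [A1 _] [B1 _].
  (* Here [u] is [g], ranging over [K]; the null set to avoid is where the translated cocycle
     identity fails. *)
  have [L cL LP] := tight_family_meet haarG mf1 A1 B1 cK.
  exists [set (x * y)%g | x in (fun x => x^-1)%g @` L & y in L].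
    apply: compact_precompact; first exact: lcsc_hausdorff.
    by apply: compactMg => //; exact: compactVg.
  move=> g Kg; apply: filterS (cocycle_inv_translate g) => x aex Ax Bgx.
  have [s [/contrapT sE Ls Lgs]] := LP _ _ _ _ Ax Bgx Kg aex.
  exists (f1 (act g x) (g * s)%g)^-1%g; first by exists (f1 (act g x) (g * s)%g).
  by exists (f1 x s) => //; rewrite /f1 sE mulgA mulVg mul1g.
- move=> L A B cL [[mA _] A2] [[mB _] B2].
  (* Here [u] is [w g x], which lies in the compact set [L]. *)
  have [M cM MP] := tight_family_meet haarH mf2 A2 B2 cL.
  apply: (@precompact_subset _ _
      [set (x * y)%g | x in M & y in (fun x => x^-1)%g @` M]); last first.
    apply: compact_precompact; first exact: lcsc_hausdorff.
    by apply: compactMg => //; exact: compactVg.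
  move=> g /=; set V := mkset _ => V0.
  have mV : measurable V.
    rewrite (_ : V = A `&` (act g @^-1` B `&` w g @^-1` L)); last first.
      by apply/seteqP; split=> [x [? ? ?]|x [? [? ?]]].
    apply: measurableI => //; apply: measurableI; rewrite -[X in measurable X]setTI.
    + exact: (nonsingular_action_null_preserving g).1.
    + by apply: mw1 => //; exact: compact_measurable_lcsc.
  (* A set of positive measure meets the conull set provided by [f2G]; a single such [x] already
     confines [g]. *)
  have [x [[Ax Bgx Lx] aex]] : exists x, V x /\ {ae mH, forall h,
      f2 (act g x) (w g x * h)%g = (g * f2 x h)%g}.
    apply: contrapT => nex; move: V0; rewrite measure_gt0 => /eqP; apply.
    apply: measure_negligible => //; apply: negligibleS (f2G g) => x Vx aex.
    by apply: nex; exists x.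
  have [h [/contrapT hE Mh Mgh]] := MP _ _ _ _ Ax Bgx Lx aex.
  exists (f2 (act g x) (w g x * h)%g) => //.
  exists (f2 x h)^-1%g; first by exists (f2 x h).
  by rewrite hE -mulgA mulgV mulg1.
Qed.

End associated_proper.

Theorem theorem4p1 (R : realType)
  (dG : measure_display) (G : lcscGroupType dG)
  (dH : measure_display) (H : lcscGroupType dH)
  (mG : {sigma_finite_measure set G -> \bar R})
  (mH : {sigma_finite_measure set H -> \bar R})
  (haarG : haar_measure mG) (haarH : haar_measure mH)
  (dO : measure_display) (Omega : measurableType dO)
  (eta : probability Omega R) (a : G * H -> Omega -> Omega)
  (corr : measure_correspondence mG mH eta a)
  (dX : measure_display) (X : measurableType dX) (mu : probability X R)
  (actX : G -> X -> X) (omega : G -> X -> H)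
  (assocX : associated mH eta (left_factor a) (right_factor a) mu actX omega)
  (dY : measure_display) (Y : measurableType dY) (nu : probability Y R)
  (actY : H -> Y -> Y) (beta : H -> Y -> G)
  (assocY : associated mG eta (right_factor a) (left_factor a) nu actY beta) :
  proper_cocycle mu actX omega /\ proper_cocycle nu actY beta.
Proof.
have [nsX cX [phi chart_phi phiG]] := assocX.
have [nsY cY [psi chart_psi psiH]] := assocY.
split.
- exact: (associated_proper haarG haarH nsX cX chart_phi.1 phiG chart_psi).
- exact: (associated_proper haarH haarG nsY cY chart_psi.1 psiH chart_phi).
Qed.
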